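(* Let $(X,\|\cdot\|)$ be a normed space, $C\subseteq X$ a nonempty convex subset and $T:C\to C$ a nonexpansive mapping. Assume that $(\lambda_n)_{n\geq 1}$ is a sequence in $[0,1]$ such that $\lim_{n\to\infty}\lambda_n=0$, $\sum_{n=1}^\infty\lambda_n$ is divergent and $\sum_{n=1}^\infty|\lambda_{n+1}-\lambda_n|$ is convergent. Moreover, let $\alpha:(0,\infty)\to\mathbb{N}^*$ be a rate of convergence of $(\lambda_n)$ (towards $0$), $\beta:(0,\infty)\to\mathbb{N}^*$ a Cauchy modulus of the sequence $s_n:=\sum_{i=1}^n|\lambda_{i+1}-\lambda_i|$, and $\theta:\mathbb{N}^*\to\mathbb{N}^*$ a rate of divergence of $\sum_{n=1}^\infty\lambda_n$. Let $x\in C$ be such that the Halpern iteration $(x_n)$ starting with $x$ is bounded. Then $\lim_{n\to\infty}\|x_n-Tx_n\|=0$ and moreover $$\forall \varepsilon\in(0,2)\ \forall n\ge \Phi(\alpha,\beta,\theta,M,\varepsilon)\ \big(\|x_n-Tx_n\|<\varepsilon\big),$$ where $$\Phi(\alpha,\beta,\theta,M,\varepsilon)=\max\left\{\theta\left(\beta\left(\frac{\varepsilon}{8M}\right)+1+\left\lceil\ln\left(\frac{8M}{\varepsilon}\right)\right\rceil\right),\ \alpha\left(\frac{\varepsilon}{4M}\right)\right\}$$ and $M\in\mathbb{N}^*$ is any number such that $M\geq\|x_n\|+\|x\|+\|Tx\|$ for all $n\geq 1$.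
   Context: $\mathbb{N}^*$ denotes the set of positive integers. A mapping $T:C\to C$ is nonexpansive if $\|Tx-Ty\|\leq\|x-y\|$ for all $x,y\in C$. For $x\in C$ and $(\lambda_n)_{n\geq1}$ in $[0,1]$, the Halpern iteration starting with $x$ is defined by $x_0:=x$ and $x_{n+1}:=\lambda_{n+1}x+(1-\lambda_{n+1})Tx_n$ for $n\geq 0$. Let $(a_n)_{n\geq1}$ be a sequence of real numbers. If $\sum_{n=1}^\infty a_n$ is divergent, a function $\gamma:\mathbb{N}^*\to\mathbb{N}^*$ is a rate of divergence of $\sum_{n=1}^\infty a_n$ if $\sum_{i=1}^{\gamma(n)}a_i\geq n$ for all $n\in\mathbb{N}^*$. If $(a_n)$ is convergent, a function $\gamma:(0,\infty)\to\mathbb{N}^*$ is a Cauchy modulus of $(a_n)$ if $a_{\gamma(\varepsilon)+n}-a_{\gamma(\varepsilon)}<\varepsilon$ for all $\varepsilon>0$ and all $n\in\mathbb{N}^*$. If $\lim_{n\to\infty}a_n=a$, a function $\gamma:(0,\infty)\to\mathbb{N}^*$ is a rate of convergence of $(a_n)$ if $|a_n-a|<\varepsilon$ for all $\varepsilon>0$ and all $n\geq\gamma(\varepsilon)$. *)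

(* Defs.v *)
From mathcomp Require Import all_boot all_order all_algebra.
From mathcomp Require Import all_classical all_reals all_analysis.

Set Implicit Arguments.
Unset Strict Implicit.
Unset Printing Implicit Defensive.

Import Order.TTheory GRing.Theory Num.Theory.
Import numFieldNormedType.Exports.

Local Open Scope classical_set_scope.
Local Open Scope ring_scope.

(* Sequences (a_n)_{n >= 1} are represented by functions on nat whose value at
   0 is never used.  Likewise, functions from the positive integers
   (resp. from the positive reals) to the positive integers are represented by
   functions nat -> nat (resp. R -> nat) that are required to be positive at
   positive arguments and are otherwise unconstrained. *)

Definition nonexpansive (R : realType) (X : normedModType R)
    (C : set X) (T : X -> X) :=
  forall x y, C x -> C y -> `|T x - T y| <= `|x - y|.

Fixpoint halpern (R : realType) (X : normedModType R) (T : X -> X)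
    (lambda : nat -> R) (x : X) (n : nat) : X :=
  if n is m.+1 then
    lambda m.+1 *: x + (1 - lambda m.+1) *: T (halpern T lambda x m)
  else x.

(* a_1 + ... + a_n; the library's [series] would start at index 0. *)
Definition psum1 (R : realType) (a : nat -> R) (n : nat) : R :=
  \sum_(1 <= i < n.+1) a i.

Definition rate_of_divergence (R : realType) (gamma : nat -> nat)
    (a : nat -> R) :=
  forall n, (0 < n)%N -> (0 < gamma n)%N /\ n%:R <= psum1 a (gamma n).

(* No absolute value is taken around the difference. *)
Definition cauchy_modulus (R : realType) (gamma : R -> nat) (a : nat -> R) :=
  forall e, 0 < e -> (0 < gamma e)%N /\
    forall n, (0 < n)%N -> a (gamma e + n)%N - a (gamma e) < e.

Definition rate_of_convergence (R : realType) (gamma : R -> nat)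
    (a : nat -> R) (l : R) :=
  forall e, 0 < e -> (0 < gamma e)%N /\
    forall n, (gamma e <= n)%N -> `|a n - l| < e.

(* [Num.ceil] is int-valued and absz takes it to nat: this is the identity
   here, as ln (8 M / e) > 0 when M >= 1 and 0 < e < 2. *)
Definition Phi (R : realType) (alpha beta : R -> nat) (theta : nat -> nat)
    (M : nat) (e : R) : nat :=
  maxn (theta (beta (e / (8 * M%:R)) + 1
               + absz (Num.ceil (ln (8 * M%:R / e))))%N)
       (alpha (e / (4 * M%:R))).

(* Main.v *)
Require Import Defs.
From mathcomp Require Import all_boot all_order all_algebra.
From mathcomp Require Import all_classical all_reals all_analysis.
From mathcomp Require Import interval_inference ring lra.

Import Order.TTheory GRing.Theory Num.Theory.
Import numFieldNormedType.Exports.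

Local Open Scope classical_set_scope.
Local Open Scope ring_scope.

(** Write d_n = `|x_{n+1} - x_n|. Subtracting two consecutive Halpern steps
    makes the anchor x appear only with the coefficient
    lambda_{n+2} - lambda_{n+1}, while nonexpansiveness contracts the rest:
      d_{n+1} <= (1 - lambda_{n+2}) d_n
                 + `|lambda_{n+2} - lambda_{n+1}| `|x - T x_n|
    ([halpern_increment_rec]), and `|x - T x_n| <= 2 M for n >= 1
    ([anchor_dist_le]). Solving this recursion with 1 - t <= exp (- t)
    ([contraction_rec_le]) gives, from any N >= 1 on,
      d_{N+k} <= exp (- (lambda_{N+2} + ... + lambda_{N+k+1})) d_N
                 + 2 M (s_{N+k} - s_N).
    The Cauchy modulus, taken at e / 8M, yields an N for which the second term
    is below e/4. As d_N <= 2 M, the first term is at most e/4 as soon as the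
    sum in the exponent reaches ln (8 M / e). The first N + 1 terms of
    the series of the lambda_i contribute at most N + 1 to it, so this happens
    once its partial sum reaches N + 1 + ceil (ln (8 M / e)), that is, past the
    value of theta in [Phi].
    Finally x_{n+1} - T x_n = lambda_{n+1} (x - T x_n), whence
    `|x_n - T x_n| <= d_n + 2 M lambda_{n+1} ([halpern_residual_le]); past
    alpha (e / 4M) the last term is below e/2.
    Convergence to 0 is the quantitative statement applied to any M that
    boundedness of the iteration provides. *)

(** * Partial sums *)

Lemma psum1D (R : realType) (a : nat -> R) (n k : nat) :
  psum1 a (n + k) = psum1 a n + \sum_(i < k) a (n + i).+1.
Proof.
elim: k => [|k IH]; first by rewrite addn0 big_ord0 addr0.
by rewrite big_ord_recr addrA -IH addnS /psum1 big_nat_recr.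
Qed.

Lemma psum1_le_natr {R : realType} {a : nat -> R} (n : nat) :
  (forall i, (1 <= i)%N -> a i <= 1) -> psum1 a n <= n%:R.
Proof.
move=> a_le1; elim: n => [|n IH]; first by rewrite /psum1 big_geq.
rewrite -[n.+1]addn1 psum1D big_ord1 natrD.
by apply: lerD => //; exact: a_le1.
Qed.

Lemma psum1_nondecreasing {R : realType} {a : nat -> R} {m n : nat} :
  (forall i, (1 <= i)%N -> 0 <= a i) -> (m <= n)%N -> psum1 a m <= psum1 a n.
Proof.
move=> a_ge0 /subnKC <-; rewrite psum1D lerDl.
by apply: sumr_ge0 => i _; exact: a_ge0.
Qed.

(** * Perturbed contractions *)

(** Unrolling the recursion gives the product of the 1 - a_i in front of d_0;
    bounding it by an exponential turns lower bounds on the sum of the a_i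
    into decay. The perturbations c_i are merely multiplied by factors at
    most 1. *)
Lemma contraction_rec_le {R : realType} {a c d : nat -> R} :
  (forall n, 0 <= a n <= 1) -> (forall n, 0 <= c n) -> (forall n, 0 <= d n) ->
  (forall n, d n.+1 <= (1 - a n) * d n + c n) ->
  forall k, d k <= expR (- \sum_(i < k) a i) * d 0%N + \sum_(i < k) c i.
Proof.
move=> a01 c_ge0 d_ge0 d_rec; elim=> [|k IH].
  by rewrite !big_ord0 oppr0 expR0 mul1r addr0.
rewrite !big_ord_recr /= opprD expRD; apply: (le_trans (d_rec k)).
have /andP[ak_ge0 ak_le1] := a01 k.
rewrite addrA lerD2r.
have exp_ge : 1 - a k <= expR (- a k) by exact: expR_ge1Dx.
have sum_ge0 : 0 <= \sum_(i < k) c i by apply: sumr_ge0.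
have factor_ge0 : 0 <= 1 - a k by rewrite subr_ge0.
apply: (le_trans (ler_wpM2l factor_ge0 IH)).
rewrite mulrDr; apply: lerD; last by apply: ler_piMl; rewrite // gerBl.
rewrite mulrA; apply: ler_wpM2r => //.
by rewrite mulrC; apply: ler_wpM2l; rewrite ?expR_ge0.
Qed.

(** * The Halpern iteration *)

Lemma halpern_in {R : realType} {X : normedModType R} {C : set X}
    {T : X -> X} {lambda : nat -> R} {x : X} :
  convex_set C -> set_fun C C T ->
  (forall n, (1 <= n)%N -> 0 <= lambda n <= 1) -> C x ->
  forall n, C (halpern T lambda x n).
Proof.
move=> convC TC lambda01 Cx; elim=> [//|n IH] /=.
have /andP[l_ge0 l_le1] := lambda01 n.+1 isT.
have := convC x (T (halpern T lambda x n)) (Itv01 l_ge0 l_le1).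
by rewrite !inE; apply=> //; exact: TC.
Qed.

(** The detour through T x is what makes the bound depend only on the norms of
    z, x and T x: T z is not bounded directly, but `|T x - T z| <= `|x - z|. *)
Lemma anchor_dist_le {R : realType} {X : normedModType R} {C : set X}
    {T : X -> X} {M : R} {x z : X} :
  nonexpansive C T -> C x -> C z -> `|z| + `|x| + `|T x| <= M ->
  `|x - T z| <= 2 * M.
Proof.
move=> nexp Cx Cz leM.
have := ler_distD (T x) x (T z); have := nexp x z Cx Cz.
have := ler_normB x (T x); have := ler_normB x z.
have := normr_ge0 z; have := normr_ge0 (T x).
lra.
Qed.

Lemma halpern_increment_rec {R : realType} {X : normedModType R} {C : set X}
    {T : X -> X} {lambda : nat -> R} {x : X} {n : nat} :
  nonexpansive C T -> (forall m, C (halpern T lambda x m)) ->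
  lambda n.+2 <= 1 ->
  `|halpern T lambda x n.+2 - halpern T lambda x n.+1| <=
    (1 - lambda n.+2) * `|halpern T lambda x n.+1 - halpern T lambda x n|
    + `|lambda n.+2 - lambda n.+1| * `|x - T (halpern T lambda x n)|.
Proof.
move=> nexp Cxn l_le1.
set u := halpern T lambda x n.+1; set v := halpern T lambda x n.
have -> : halpern T lambda x n.+2 - u =
    (1 - lambda n.+2) *: (T u - T v) + (lambda n.+2 - lambda n.+1) *: (x - T v).
  have uE : u = lambda n.+1 *: x + (1 - lambda n.+1) *: T v by [].
  have -> : halpern T lambda x n.+2 =
      lambda n.+2 *: x + (1 - lambda n.+2) *: T u by [].
  rewrite {2}uE opprD addrACA -scalerBl.
  have -> : 1 - lambda n.+1 = (1 - lambda n.+2) + (lambda n.+2 - lambda n.+1).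
    by rewrite addrA subrK.
  by rewrite [_ *: T v]scalerDl opprD [_ *: T u + _]addrA -scalerBr addrCA -scalerBr.
apply: (le_trans (ler_normD _ _)); rewrite !normrZ.
rewrite (ger0_norm (_ : 0 <= 1 - lambda n.+2)) ?subr_ge0// lerD2r.
by apply: ler_wpM2l; [rewrite subr_ge0 | exact: (nexp _ _ (Cxn n.+1) (Cxn n))].
Qed.

Lemma halpern_residual_le {R : realType} {X : normedModType R}
    {T : X -> X} {lambda : nat -> R} {x : X} {n : nat} :
  0 <= lambda n.+1 ->
  `|halpern T lambda x n - T (halpern T lambda x n)| <=
    `|halpern T lambda x n.+1 - halpern T lambda x n|
    + lambda n.+1 * `|x - T (halpern T lambda x n)|.
Proof.
move=> l_ge0; set v := halpern T lambda x n.
have step : halpern T lambda x n.+1 - T v = lambda n.+1 *: (x - T v).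
  by rewrite /= -/v scalerBl scale1r scalerBr [T v - _]addrC addrA addrK.
rewrite -[X in _ + X * _](ger0_norm l_ge0) -normrZ -step.
by rewrite -[X in _ <= X + _]distrC; exact: ler_distD.
Qed.

(** The initial increment d_N is at most 2 M, so the decay factor has to fall to
    e / 8M, whose logarithm is the one in the hypothesis. The summand N + 1
    there pays for the terms of index at most N + 1, which the recursion started
    at N does not see. *)
Lemma halpern_increment_lt {R : realType} {X : normedModType R} {C : set X}
    {T : X -> X} {lambda : nat -> R} {x : X} {M e : R} {N n : nat} :
  nonexpansive C T -> (forall m, C (halpern T lambda x m)) ->
  (forall m, (1 <= m)%N -> 0 <= lambda m <= 1) ->
  0 < M -> 0 < e -> (0 < N <= n)%N ->
  (forall m, (1 <= m)%N ->
     `|halpern T lambda x m| + `|x| + `|T x| <= M) ->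
  psum1 (fun i => `|lambda i.+1 - lambda i|) n
    - psum1 (fun i => `|lambda i.+1 - lambda i|) N < e / (8 * M) ->
  N.+1%:R + ln (8 * M / e) <= psum1 lambda n ->
  `|halpern T lambda x n.+1 - halpern T lambda x n| < e / 2.
Proof.
move=> nexp Cxn lambda01 M_gt0 e_gt0 /andP[N_gt0 leNn] leM.
rewrite -(subnKC leNn); move: (n - N)%N => k {n leNn}.
rewrite psum1D addrAC subrr add0r => var_lt sum_ge.
pose d i := `|halpern T lambda x (N + i).+1 - halpern T lambda x (N + i)|.
pose c i := 2 * M * `|lambda (N + i).+2 - lambda (N + i).+1|.
have Cx : C x by exact: (Cxn 0%N).
have d_rec i : d i.+1 <= (1 - lambda (N + i).+2) * d i + c i.
  rewrite /d /c addnS.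
  have /andP[_ l_le1] := lambda01 (N + i).+2 isT.
  apply: (le_trans (halpern_increment_rec nexp Cxn l_le1)).
  rewrite lerD2l mulrC; apply: ler_wpM2r => //.
  apply: (anchor_dist_le nexp Cx (Cxn _)).
  by apply: leM; rewrite addn_gt0 N_gt0.
have d_le : d k <= expR (- \sum_(i < k) lambda (N + i).+2) * d 0%N
                   + \sum_(i < k) c i.
  apply: (contraction_rec_le (a := fun i => lambda (N + i).+2)) => // i.
  - exact: lambda01.
  - by rewrite /c !mulr_ge0// ltW.
  - exact: normr_ge0.
have d0_le : d 0%N <= 2 * M.
  rewrite /d addn0.
  have := ler_normB (halpern T lambda x N.+1) (halpern T lambda x N).
  have := leM N.+1 isT; have := leM N N_gt0.
  have := normr_ge0 x; have := normr_ge0 (T x); lra.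
have c_lt : \sum_(i < k) c i < e / 4.
  rewrite -mulr_sumr (_ : e / 4 = 2 * M * (e / (8 * M))).
    by rewrite ltr_pM2l// mulr_gt0.
  by field; rewrite gt_eqF.
have sum_tail : ln (8 * M / e) <= \sum_(i < k) lambda (N + i).+2.
  have lambda_le1 m : (1 <= m)%N -> lambda m <= 1.
    by move=> /lambda01/andP[].
  have lambda_ge0 m : (1 <= m)%N -> 0 <= lambda m.
    by move=> /lambda01/andP[].
  have := psum1_le_natr N.+1 lambda_le1.
  have := psum1_nondecreasing lambda_ge0 (leqnSn (N + k)).
  rewrite -addSn [psum1 _ (N.+1 + k)]psum1D /=; lra.
have exp_le : expR (- \sum_(i < k) lambda (N + i).+2) * d 0%N <= e / 4.
  have : expR (- \sum_(i < k) lambda (N + i).+2) <= e / (8 * M).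
    have pos : 0 < 8 * M / e by rewrite divr_gt0// mulr_gt0.
    rewrite expRN -invf_div lef_pV2 ?posrE ?expR_gt0//.
    by rewrite -{1}(lnK (pos : _ \is Num.pos)) ler_expR.
  move=> exp_le.
  have -> : e / 4 = e / (8 * M) * (2 * M) by field; rewrite gt_eqF.
  by apply: ler_pM; rewrite ?expR_ge0 ?normr_ge0.
rewrite -/(d k); lra.
Qed.

Theorem theorem2p1 (R : realType) (X : normedModType R)
    (C : set X) (hC0 : C !=set0) (hC : convex_set C)
    (T : X -> X) (hTC : set_fun C C T) (hT : nonexpansive C T)
    (lambda : nat -> R)
    (hlambda : forall n, (1 <= n)%N -> 0 <= lambda n <= 1)
    (hlim : lambda n @[n --> \oo] --> (0 : R))
    (hdiv : ~ cvgn (psum1 lambda))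
    (hcvg : cvgn (psum1 (fun i => `|lambda i.+1 - lambda i|)))
    (alpha : R -> nat) (halpha : rate_of_convergence alpha lambda 0)
    (beta : R -> nat)
    (hbeta : cauchy_modulus beta (psum1 (fun i => `|lambda i.+1 - lambda i|)))
    (theta : nat -> nat) (htheta : rate_of_divergence theta lambda)
    (x : X) (hx : C x)
    (hbounded : bounded_fun (halpern T lambda x)) :
  `|halpern T lambda x n - T (halpern T lambda x n)| @[n --> \oo] --> (0 : R)
  /\
  forall M : nat, (0 < M)%N ->
    (forall n, (1 <= n)%N ->
      `|halpern T lambda x n| + `|x| + `|T x| <= M%:R) ->
    forall e : R, 0 < e < 2 ->
    forall n : nat, (Phi alpha beta theta M e <= n)%N ->
      `|halpern T lambda x n - T (halpern T lambda x n)| < e.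
Proof.
have Cxn := halpern_in hC hTC hlambda hx.
have quant (M : nat) : (0 < M)%N ->
    (forall n, (1 <= n)%N ->
      `|halpern T lambda x n| + `|x| + `|T x| <= M%:R) ->
    forall e : R, 0 < e < 2 ->
    forall n : nat, (Phi alpha beta theta M e <= n)%N ->
      `|halpern T lambda x n - T (halpern T lambda x n)| < e.
  move=> M_gt0 leM e /andP[e_gt0 e_lt2] n.
  rewrite /Phi geq_max => /andP[].
  have M_ge1 : (1 : R) <= M%:R by rewrite ler1n.
  have M_pos : (0 : R) < M%:R by rewrite ltr0n.
  have e8_gt0 : 0 < e / (8 * M%:R) by rewrite divr_gt0// mulr_gt0.
  have e4_gt0 : 0 < e / (4 * M%:R) by rewrite divr_gt0// mulr_gt0.
  have [N_gt0 cauchyN] := hbeta _ e8_gt0.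
  have [_ small] := halpha _ e4_gt0.
  set N := beta _ in N_gt0 cauchyN *; set L := absz _ => le_theta le_alpha.
  have ln_le : ln (8 * M%:R / e) <= L%:R.
    have ceil_nneg : 0 <= Num.ceil (ln (8 * M%:R / e)).
      rewrite ceil_ge0 (lt_le_trans _ (ln_ge0 _))// ?oppr_lt0//.
      by rewrite ler_pdivlMr//; lra.
    rewrite /L natr_absz ger0_norm//; exact: ceil_ge.
  have [theta_gt0 theta_div] : (0 < theta (N + 1 + L))%N /\
      (N + 1 + L)%:R <= psum1 lambda (theta (N + 1 + L)).
    by apply: htheta; rewrite addn1.
  have lambda_le1 m : (1 <= m)%N -> lambda m <= 1.
    by move=> /hlambda/andP[].
  have lambda_ge0 m : (1 <= m)%N -> 0 <= lambda m.
    by move=> /hlambda/andP[].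
  have sum_ge : (N + 1 + L)%:R <= psum1 lambda n.
    exact: le_trans theta_div (psum1_nondecreasing lambda_ge0 le_theta).
  have ltNn : (N < n)%N.
    (* Each lambda_i is at most 1, so a sum of at least N + 1 has as many
       terms. *)
    have := le_trans sum_ge (psum1_le_natr n lambda_le1).
    by rewrite ler_nat addn1; apply: leq_trans; rewrite leq_addr.
  have increment_lt : `|halpern T lambda x n.+1 - halpern T lambda x n| < e / 2.
    apply: (halpern_increment_lt (N := N) hT Cxn hlambda M_pos) => //.
    - by rewrite N_gt0 ltnW.
    - by rewrite -(subnKC (ltnW ltNn)); apply: cauchyN; rewrite subn_gt0.
    - by apply: le_trans sum_ge; rewrite addn1 natrD lerD2l.
  have lambda_lt : lambda n.+1 < e / (4 * M%:R).
    by apply: le_lt_trans (ler_norm _) _; rewrite -[lambda _]subr0 small// leqW.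
  have anchor : `|x - T (halpern T lambda x n)| <= 2 * M%:R.
    by apply: (anchor_dist_le hT hx (Cxn n)); apply: leM; exact: leq_ltn_trans ltNn.
  apply: (le_lt_trans (halpern_residual_le (lambda_ge0 n.+1 isT))).
  have : lambda n.+1 * `|x - T (halpern T lambda x n)| <= e / 2.
    have -> : e / 2 = e / (4 * M%:R) * (2 * M%:R) by field; rewrite gt_eqF.
    by apply: ler_pM => //; [exact: lambda_ge0 | exact: ltW].
  lra.
split=> //.
have [K [_ leK]] := hbounded.
pose B := `|K| + 1 + `|x| + `|T x|.
have B_ge0 : 0 <= B by rewrite !addr_ge0.
have ltB := archi_boundP B_ge0.
have leM n : (1 <= n)%N ->
    `|halpern T lambda x n| + `|x| + `|T x| <= (Num.bound B)%:R.
  move=> _; apply: le_trans (ltW ltB); rewrite /B !lerD2r.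
  by apply: leK => //; rewrite (le_lt_trans (ler_norm K))// ltrDl.
have M_gt0 : (0 < Num.bound B)%N by rewrite -(ltr0n R) (le_lt_trans B_ge0).
apply/cvgrPdist_lt => e e_gt0.
(* The quantitative bound is stated for errors below 2 only. *)
have min_itv : 0 < Num.min e 1 < 2.
  by rewrite lt_min e_gt0 ltr01 /= gt_min ltr1n orbT.
exists (Phi alpha beta theta (Num.bound B) (Num.min e 1)) => // n /= le_n.
rewrite sub0r normrN normr_id.
apply: (lt_le_trans (quant _ M_gt0 leM _ min_itv n le_n)).
by rewrite ge_min lexx.
Qed.
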